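(* Let $\Sigma=\{L_1,\dots,L_n\}$ be a finite family of mutually skew lines in $\mathbb{R}^4$ such that the three dimensional affine hull of every two lines in $\Sigma$ contains at least one more line of $\Sigma$. Let $H_1,\dots,H_m$ be the distinct three dimensional affine hulls of pairs of distinct lines of $\Sigma$, and suppose $m\geq 2$. If there is a point $O\in\bigcap_{i=1}^m H_i$, then there exists a line $L\subset\mathbb{R}^4$ passing through $O$, different from each $L_i$, such that $L_i$ and $L$ are coplanar for each $1\leq i\leq n$.
   Context: Two lines are skew if they are neither intersecting nor parallel, equivalently their affine hull (smallest affine subspace containing both) is three dimensional. Mutually skew means pairwise skew. Two lines are coplanar if they lie in a common two dimensional affine plane. *)

(* Defs.v *)
From HB Require Import structures.
From mathcomp Require Import all_boot all_order all_algebra.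
From mathcomp Require Import classical_sets reals.

Set Implicit Arguments.
Unset Strict Implicit.
Unset Printing Implicit Defensive.

Import Order.TTheory GRing.Theory Num.Theory.

Local Open Scope classical_set_scope.
Local Open Scope ring_scope.

Section Affine.
Variables (R : realType) (d : nat).
Implicit Types (p x : 'rV[R]_d) (V : {vspace 'rV[R]_d}) (A B L : set 'rV[R]_d).

Definition flat p V : set 'rV[R]_d := [set x | x - p \in V].

(* Nonempty affine subspaces: the empty set is not counted. *)
Definition affine_subspace A : Prop := exists p V, A = flat p V.

Definition affine_subspace_dim (k : nat) A : Prop :=
  exists p V, \dim V = k /\ A = flat p V.

Definition is_line A : Prop := affine_subspace_dim 1 A.

Definition is_plane A : Prop := affine_subspace_dim 2 A.

(* For nonempty A this is the smallest affine subspace containing A. *)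
Definition affine_hull A : set 'rV[R]_d :=
  [set x | forall B, affine_subspace B -> A `<=` B -> B x].

(* Same direction space; in particular a line is parallel to itself. *)
Definition parallel L1 L2 : Prop :=
  exists p1 p2 V, L1 = flat p1 V /\ L2 = flat p2 V.

Definition skew_lines L1 L2 : Prop :=
  ~ (L1 `&` L2 !=set0) /\ ~ parallel L1 L2.

Definition coplanar L1 L2 : Prop :=
  exists P, [/\ is_plane P, L1 `<=` P & L2 `<=` P].

End Affine.

(* Main.v *)
Require Import Defs.
From HB Require Import structures.
From mathcomp Require Import all_boot all_order all_algebra.
From mathcomp Require Import classical_sets reals.
From mathcomp Require Import boolp zify.

Set Implicit Arguments.
Unset Strict Implicit.
Unset Printing Implicit Defensive.

Import Order.TTheory GRing.Theory Num.Theory.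

Local Open Scope classical_set_scope.
Local Open Scope ring_scope.

(** Take [O] as origin and let [P i] be the linear span of [L i], so that
    [P i] is a plane unless [L i] passes through [O], which happens for at most
    one [i].  Since [O] lies in the hull of [L i] and [L j], that hull is
    [P i + P j], of dimension 3.  Hence the planes [P i] meet pairwise in lines,
    and as lines of projective 3-space they are concurrent or coplanar.  In the
    coplanar case the third-line hypothesis puts the exceptional [P i] in the
    same hyperplane, so that all hulls coincide.  In the concurrent case the
    common line [M] is the line sought; both [M <> L i] and coplanarity follow
    from [\dim (P i + M) = 2]. *)

(** * Linear algebra of subspaces with three-dimensional pairwise sums *)

Section PairwiseMeetingSubspaces.
Variables (K : fieldType) (vT : vectType K).
Implicit Types U V W : {vspace vT}.

Lemma dimv_add_vector V (v : vT) : (\dim (V + <[v]>) <= (\dim V).+1)%N.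
Proof.
have [+ _] := dimv_add_leqif V <[v]>%VS => /leq_trans; apply.
by rewrite dim_vline -addn1 leq_add2l leq_b1.
Qed.

Lemma eqv_of_subv U V : (U <= V)%VS -> (\dim V <= \dim U)%N -> U = V.
Proof. by move=> UV dVU; apply/eqP; rewrite eqEdim UV. Qed.

(** Dimension 1 is allowed for the span of a line through the origin; the sums of dimension 3 leave
    room for at most one such index. *)
Lemma common_line_of_pairwise_meeting n (P : 'I_n -> {vspace vT}) :
    (forall i, 1 <= \dim (P i) <= 2)%N ->
    (forall i j, i != j -> \dim (P i + P j) = 3) ->
    (forall i j, i != j ->
       exists k, [/\ k != i, k != j & (P k <= P i + P j)%VS]) ->
    (exists i j k l,
       [/\ i != j, k != l & (P i + P j != P k + P l)%VS]) ->
  exists2 M : {vspace vT}, \dim M = 1 & forall i, \dim (P i + M) = 2.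
Proof.
move=> dimP dimPP third [i1 [j1 [i2 [j2 [ij1 ij2 nePP]]]]].
have dim_meet a b : a != b -> \dim (P a) = 2 -> \dim (P b) = 2 ->
    \dim (P a :&: P b) = 1.
  move=> ab da db; have := dimv_sum_cap (P a) (P b).
  by rewrite dimPP // da db => -[].
have plane_of_neq i j : i != j -> \dim (P i) != 2 -> \dim (P j) = 2.
  move=> ij di; have := dimP i; have := dimP j; have := dimPP _ _ ij.
  have := dimv_add_leqif (P i) (P j) => -[+ _].
  by move: di; lia.
(* At most one of the three distinct indices [i1], [j1], [k] is exceptional. *)
have [a [b [ab da db]]] :
    exists a b, [/\ a != b, \dim (P a) = 2 & \dim (P b) = 2].
  have [k [ki kj _]] := third _ _ ij1.
  have [di|di] := eqVneq (\dim (P i1)) 2.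
    have [dj|dj] := eqVneq (\dim (P j1)) 2; first by exists i1, j1.
    exists i1, k; rewrite eq_sym; split=> //.
    by apply: (plane_of_neq j1); rewrite // eq_sym.
  exists j1, k; rewrite eq_sym; split=> //; first exact: (plane_of_neq i1).
  by apply: (plane_of_neq i1); rewrite // eq_sym.
pose M := (P a :&: P b)%VS; have dM : \dim M = 1 by exact: dim_meet.
have plane_span U V k : \dim U = 1 -> \dim V = 1 -> U != V ->
    \dim (P k) = 2 -> (U <= P k)%VS -> (V <= P k)%VS -> (P k <= U + V)%VS.
  move=> dU dV UV dk Uk Vk.
  suff -> : (U + V)%VS = P k by [].
  apply: eqv_of_subv; first by rewrite subv_add Uk.
  rewrite dk ltnNge; apply: contra UV => dUV.
  have EU : U = (U + V)%VS by apply: eqv_of_subv; rewrite ?addvSl // dU.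
  have EV : V = (U + V)%VS by apply: eqv_of_subv; rewrite ?addvSr // dV.
  by rewrite {1}EU -EV.
(* Concurrent case: every plane contains [M]. *)
have [all_M|] := boolP [forall k, (\dim (P k) == 2) ==> (M <= P k)%VS].
  exists M => // k.
  have [dk|dk] := eqVneq (\dim (P k)) 2.
    move/forallP/(_ k): all_M; rewrite dk eqxx /= => Mk.
    by have/addv_idPl -> := Mk.
  have ka : k != a by apply: contraNneq dk => ->; rewrite da.
  have d1 : \dim (P k) = 1 by have := dimP k; move: dk; lia.
  have := dimv_add_leqif (P k) M => -[+ _]; rewrite d1 dM => le2.
  (* Otherwise the exceptional [P k] would equal [M] and lie in [P a], so that [P k + P a] would
     have dimension only 2. *)
  apply/eqP; rewrite eqn_leq le2 ltnNge; apply/negP => le1.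
  have EU : P k = (P k + M)%VS by apply: eqv_of_subv; rewrite ?addvSl // d1.
  have EV : M = (P k + M)%VS by apply: eqv_of_subv; rewrite ?addvSr // dM.
  have : (P k <= P a)%VS by rewrite EU -EV capvSl.
  by move/addv_idPr=> Eka; move: (dimPP _ _ ka); rewrite Eka da.
rewrite negb_forall => /existsP[c]; rewrite negb_imply => /andP[/eqP dc Mc].
(* A plane avoiding [M] meets [P a] and [P b] in distinct lines, since a common one would be
   [P a :&: P b], that is [M]; these two lines span it. *)
have in_W k : \dim (P k) = 2 -> ~~ (M <= P k)%VS -> (P k <= P a + P b)%VS.
  move=> dk Mk.
  have ka : k != a by apply: contraNneq Mk => ->; rewrite capvSl.
  have kb : k != b by apply: contraNneq Mk => ->; rewrite capvSr.
  apply: (@subv_trans _ _ (P k :&: P a + P k :&: P b)%VS); last first.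
    by apply: addvS; apply: capvSr.
  apply: plane_span; rewrite ?capvSl ?dim_meet //.
  apply: contra Mk => /eqP E.
  suff <- : (P k :&: P a)%VS = M by rewrite capvSl.
  apply: eqv_of_subv; last by rewrite dM dim_meet.
  by rewrite subv_cap capvSr E capvSr.
have all_W k : \dim (P k) = 2 -> (P k <= P a + P b)%VS.
  move=> dk; have [Mk|] := boolP (M <= P k)%VS; last exact: in_W.
  have kc : k != c by apply: contraNneq Mc => <-.
  (* A plane through [M] is spanned by [M] and its meet with [P c], and [P c] is already covered by
     [in_W]. *)
  apply: (@subv_trans _ _ (M + P k :&: P c)%VS).
    apply: plane_span; rewrite ?capvSl ?dim_meet //.
    by apply: contra Mc => /eqP ->; rewrite capvSr.
  rewrite subv_add (subv_trans (capvSr _ _) (in_W _ dc Mc)) andbT.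
  exact: subv_trans (capvSl _ _) (addvSl _ _).
have all_sub i : (P i <= P a + P b)%VS.
  have [di|di] := eqVneq (\dim (P i)) 2; first exact: all_W.
  have ia : i != a by apply: contraNneq di => ->; rewrite da.
  (* For the exceptional [i], the third index [k] is a plane, and equal dimensions turn [P i + P a]
     into a sum of two planes already placed. *)
  have [k [ki ka kU]] := third _ _ ia.
  have ik : i != k by rewrite eq_sym.
  have dk := plane_of_neq _ _ ik di.
  have E1 : (P k + P a = P i + P a)%VS.
    by apply: eqv_of_subv; rewrite ?dimPP // subv_add kU addvSr.
  rewrite (subv_trans (addvSl _ (P a))) // -E1.
  by rewrite subv_add all_W // addvSl.
have sumW i j : i != j -> (P i + P j = P a + P b)%VS.
  by move=> ij; apply: eqv_of_subv; rewrite ?dimPP // subv_add !all_sub.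
by rewrite !sumW ?eqxx in nePP.
Qed.

End PairwiseMeetingSubspaces.

(** * Affine flats and the hull of two skew lines *)

Section Flats.
Variables (R : realType) (d : nat).
Implicit Types (p q x : 'rV[R]_d) (U V : {vspace 'rV[R]_d}).

Lemma flat_base p V : flat p V p.
Proof. by rewrite /flat /= subrr mem0v. Qed.

Lemma flat_rebase p q V : flat p V q -> flat p V = flat q V.
Proof.
rewrite /flat /= => qp; apply/seteqP; split=> x /= xV.
  have -> : x - q = (x - p) - (q - p) by rewrite opprB addrA subrK.
  exact: rpredB.
have -> : x - p = (x - q) + (q - p) by rewrite addrA subrK.
exact: rpredD.
Qed.

Lemma sub_flat p V q U :
  flat p V `<=` flat q U <-> (V + <[p - q]> <= U)%VS.
Proof.
rewrite subv_add -memvE; split=> [sub|/andP[/subvP VU pq] x xV].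
  have pq := sub _ (flat_base p V).
  rewrite pq andbT; apply/subvP => v vV.
  have /sub : flat p V (v + p) by rewrite /flat /= addrK.
  by rewrite /flat /= -addrA => vU; rewrite -(addrK (p - q) v) rpredB.
by rewrite /flat /= -(subrK p x) -addrA rpredD //; apply: VU.
Qed.

(** Any affine subspace containing both flats contains [O], hence can be rebased there; containment
    then becomes linear. *)
Lemma affine_hull_flatU p1 p2 V1 V2 O :
    affine_hull (flat p1 V1 `|` flat p2 V2) O ->
  affine_hull (flat p1 V1 `|` flat p2 V2)
  = flat O ((V1 + <[p1 - O]>) + (V2 + <[p2 - O]>)).
Proof.
move=> hullO; apply/seteqP; split=> x.
  apply; first by eexists; eexists.
  by rewrite subUset; split; apply/sub_flat; rewrite ?addvSl ?addvSr.
move=> xP B affB subB; have := hullO B affB subB.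
case: affB subB => p [U ->] subB OU; rewrite (flat_rebase OU) in subB *.
move: subB; rewrite subUset => -[/sub_flat s1 /sub_flat s2].
by apply: (subvP _ _ xP); rewrite subv_add s1.
Qed.

Lemma dimv_skew_join p1 p2 V1 V2 O :
    \dim V1 = 1 -> \dim V2 = 1 -> skew_lines (flat p1 V1) (flat p2 V2) ->
    affine_hull (flat p1 V1 `|` flat p2 V2) O ->
  \dim ((V1 + <[p1 - O]>) + (V2 + <[p2 - O]>)) = 3.
Proof.
move=> d1 d2 [disj npar] hullO; apply/eqP; rewrite eqn_leq; apply/andP; split.
  (* Upper bound: [U] has dimension at most 1 + 1 + 1, and it contains [p1 - O] because [O] lies in
     the hull. *)
  pose U := (V1 + V2 + <[p2 - p1]>)%VS.
  have OU : flat p1 U O.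
    apply: hullO; first by eexists; eexists.
    rewrite subUset; split; apply/sub_flat.
      by rewrite subrr subv_add -memvE mem0v andbT /U -addvA addvSl.
    by rewrite /U -addvA addvSr.
  have p1O : p1 - O \in U by rewrite -opprB rpredN.
  have p21 : p2 - p1 \in U by rewrite memvE addvSr.
  have p2O : p2 - O \in U.
    have -> : p2 - O = (p2 - p1) + (p1 - O) by rewrite addrA subrK.
    exact: rpredD.
  apply: (@leq_trans (\dim U)).
    apply: dimvS; rewrite !subv_add -!memvE p1O p2O !andbT.
    by rewrite -subv_add addvSl.
  apply: leq_trans (dimv_add_vector _ _) _; rewrite ltnS.
  by have [+ _] := dimv_add_leqif V1 V2; rewrite d1 d2.
rewrite ltnNge; apply/negP => le2.
have neV : V1 <> V2 by move=> E; apply: npar; exists p1, p2, V1; rewrite E.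
have d12 : (2 <= \dim (V1 + V2))%N.
  rewrite ltnNge; apply/negP => le1; apply: neV.
  have E1 : V1 = (V1 + V2)%VS by apply/eqP; rewrite eqEdim addvSl d1.
  have E2 : V2 = (V1 + V2)%VS by apply/eqP; rewrite eqEdim addvSr d2.
  by rewrite {1}E1 -E2.
(* If the dimension were at most 2, the join would reduce to [V1 + V2]; then [p1 - p2] splits as
   [v1 + v2], and [p1 - v1] is a common point of the lines. *)
have E : (V1 + V2 = (V1 + <[p1 - O]>) + (V2 + <[p2 - O]>))%VS.
  apply/eqP; rewrite eqEdim (leq_trans le2 d12) andbT.
  by apply: addvS; apply: addvSl.
have : p1 - p2 \in (V1 + V2)%VS.
  have -> : p1 - p2 = (p1 - O) - (p2 - O) by rewrite opprB addrA subrK.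
  rewrite E rpredB // memvE.
    by rewrite (subv_trans _ (addvSl _ _)) // addvSr.
  by rewrite (subv_trans _ (addvSr _ _)) // addvSr.
case/memv_addP => v1 v1V [v2 v2V e]; apply: disj; exists (p1 - v1).
split; rewrite /flat /=; first by rewrite addrC addKr rpredN.
by rewrite addrAC e addrC addKr.
Qed.

End Flats.

Theorem mainTheorem6 (R : realType) (n : nat) (L : 'I_n -> set 'rV[R]_4)
    (L_line : forall i, is_line (L i))
    (L_skew : forall i j : 'I_n, i != j -> skew_lines (L i) (L j))
    (L_third : forall i j : 'I_n, i != j ->
       exists k : 'I_n, [/\ k != i, k != j & L k `<=` affine_hull (L i `|` L j)])
    (m : nat) (H : 'I_m -> set 'rV[R]_4)
    (H_inj : injective H)
    (H_hulls : range H =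
       [set A | exists i j : 'I_n, i != j /\ A = affine_hull (L i `|` L j)])
    (m_ge2 : (2 <= m)%N)
    (O : 'rV[R]_4) (O_in : (\bigcap_k H k) O) :
  exists M : set 'rV[R]_4,
    [/\ is_line M, M O, (forall i, M <> L i) & forall i, coplanar (L i) M].
Proof.
have /boolp.choice[p /boolp.choice[V LV]] := L_line.
have dV i : \dim (V i) = 1 by case: (LV i).
have LE i : L i = flat (p i) (V i) by case: (LV i).
pose P i := (V i + <[p i - O]>)%VS.
have hullO i j : i != j -> affine_hull (L i `|` L j) O.
  move=> ij; have : range H (affine_hull (L i `|` L j)).
    by rewrite H_hulls; exists i, j.
  by case=> k _ <-; apply: O_in.
have hullE i j : i != j -> affine_hull (L i `|` L j) = flat O (P i + P j).
  by move=> /hullO; rewrite !LE; apply: affine_hull_flatU.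
have dimPP i j : i != j -> \dim (P i + P j) = 3.
  move=> ij; apply: dimv_skew_join; rewrite ?dV -?LE //; first exact: L_skew.
  exact: hullO.
have [||||M dM PM] := @common_line_of_pairwise_meeting _ _ n P.
- move=> i; apply/andP; split; last first.
    by rewrite (leq_trans (dimv_add_vector _ _)) ?dV.
  by rewrite (leq_trans _ (dimvS (addvSl _ _))) ?dV.
- exact: dimPP.
- move=> i j ij; have [k [ki kj]] := L_third i j ij.
  by rewrite hullE // LE => /sub_flat; exists k.
- have hullH (k : 'I_m) : exists i j, i != j /\ H k = flat O (P i + P j).
    have : range H (H k) by exists k.
    by rewrite H_hulls => -[i [j [ij ->]]]; exists i, j; rewrite hullE.
  (* Indices 0 and 1 exist as [m >= 2]; injectivity of [H] separates their hulls. *)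
  have [i [j [ij Hij]]] := hullH (Ordinal (ltnW m_ge2)).
  have [k [l [kl Hkl]]] := hullH (Ordinal m_ge2).
  exists i, j, k, l; split=> //; apply/eqP => E.
  have := H_inj (Ordinal (ltnW m_ge2)) (Ordinal m_ge2).
  by rewrite Hij Hkl E => /(_ erefl).
exists (flat O M); split.
- by exists O, M.
- exact: flat_base.
(* If [L i] were this line, [P i] would lie in [M], forcing [P i + M] to have dimension 1. *)
- move=> i E; have := PM i.
  have : flat (p i) (V i) `<=` flat O M by rewrite -LE E.
  by move=> /sub_flat/addv_idPr ->; rewrite dM.
move=> i; exists (flat O (P i + M)); split.
- by exists O, (P i + M)%VS.
- by rewrite LE; apply/sub_flat; rewrite addvSl.
- by apply/sub_flat; rewrite subrr subv_add addvSr -memvE mem0v.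
Qed.
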